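(* Let $n\ge 1$ and let $G$ be one of $GL(n)$, $SO(2n+1)$, $Sp(2n)$, $SO(2n)$, with weight lattice $\Lambda_G$, dominant weights $\Lambda_G^+$, Weyl group $W_G$, Weyl vector $\rho_G$ and characters $\mathrm{ch}^G_\lambda(\mathbf{x})$ as described in the context. For all coefficients $a(\kappa)$, $\kappa\in\Lambda_G$, such that $$\sum_{\kappa\in\Lambda_G} a(\kappa)\,\mathbf{x}^\kappa=\sum_{\kappa\in\Lambda_G} a(\kappa)\,\mathbf{x}^{w(\kappa)}\qquad\text{for any } w\in W_G ,$$ we have $$\sum_{\kappa\in\Lambda_G} a(\kappa)\,\mathbf{x}^\kappa=\sum_{\lambda\in\Lambda_G^+}\ \sum_{\kappa\in\Lambda_G}\ \mathrm{sgn}(w_{\kappa,\lambda})\,a(\kappa)\,\mathrm{ch}^G_\lambda(\mathbf{x}),$$ where the summation is over those $\kappa$ for which there exists $w_{\kappa,\lambda}\in W_G$ such that $w_{\kappa,\lambda}(\kappa+\rho_G)-\rho_G=\lambda$.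
   Context: $\mathbf{x}=(x_1,\dots,x_n)$ are indeterminates and $\mathbf{x}^\kappa=x_1^{\kappa_1}\cdots x_n^{\kappa_n}$ for $\kappa=(\kappa_1,\dots,\kappa_n)$ (half-odd-integer exponents are allowed where needed). Weights are vectors in $n$-dimensional Euclidean space with orthonormal basis $\epsilon_1,\dots,\epsilon_n$. Weight lattices: $\Lambda_G=\mathbb{Z}^n$ for $GL(n)$ and $Sp(2n)$; for $SO(2n+1)$ and $SO(2n)$, $\Lambda_G=\mathbb{Z}^n\cup(\mathbb{Z}+\tfrac12)^n$ (spin weights are included). Weyl groups: $W_G$ is $S_n$ permuting coordinates for $GL(n)$; the group $(\mathbb{Z}_2)^n\rtimes S_n$ of all permutations and sign changes of coordinates for $SO(2n+1)$ and $Sp(2n)$; the group $(\mathbb{Z}_2)^{n-1}\rtimes S_n$ of all permutations and even numbers of sign changes for $SO(2n)$. $\mathrm{sgn}(w)=\pm1$ is the signature (parity) of $w$, i.e. its determinant as a linear map. Weyl vectors (half the sum of the positive roots): $\rho_G=\sum_{i=1}^n (n-i)\epsilon_i$ for $GL(n)$ (in the usual normalisation for $GL(n)$, up to a multiple of $\sum_i\epsilon_i$) and for $SO(2n)$; $\sum_{i=1}^n(n+\tfrac12-i)\epsilon_i$ for $SO(2n+1)$; $\sum_{i=1}^n(n+1-i)\epsilon_i$ for $Sp(2n)$. $\Lambda_G^+\subset\Lambda_G$ is the set of dominant weights: $\lambda_1\ge\cdots\ge\lambda_n$ for $GL(n)$; $\lambda_1\ge\cdots\ge\lambda_n\ge0$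 for $SO(2n+1)$ and $Sp(2n)$; $\lambda_1\ge\cdots\ge\lambda_{n-1}\ge|\lambda_n|$ for $SO(2n)$. For $\lambda\in\Lambda_G^+$ the character of the irreducible representation of $G$ of highest weight $\lambda$ is given by Weyl's formula $$\mathrm{ch}^G_\lambda(\mathbf{x})=\frac{\sum_{w\in W_G}\mathrm{sgn}(w)\,\mathbf{x}^{w(\lambda+\rho_G)}}{\sum_{w\in W_G}\mathrm{sgn}(w)\,\mathbf{x}^{w(\rho_G)}} .$$
   Formalization: The coefficients a(κ) are assumed to be nonzero for only finitely many κ (values in an integral domain); for arbitrary infinite families the identity fails, e.g. for GL(2) with a(κ)=1 for all κ the right side is 0. *)

(* Defs.v *)
From HB Require Import structures.
From mathcomp Require Import all_boot all_order all_algebra all_fingroup.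
From mathcomp Require Import boolp classical_sets cardinality fsbigop.
From mathcomp Require Import mpoly.

Set Implicit Arguments.
Unset Strict Implicit.
Unset Printing Implicit Defensive.

Import Order.TTheory GRing.Theory Num.Theory.

Local Open Scope ring_scope.
Local Open Scope classical_set_scope.

(* GL(n), SO(2n+1), Sp(2n), SO(2n); all four have rank n. *)
Inductive classical_group := GL | SOodd | Sp | SOeven.

(* Coordinates in the basis epsilon_1, ..., epsilon_n. Every weight in use has
   coordinates in (1/2)Z, so rational coordinates suffice. Indices of 'I_n
   start at 0: [k 0 i] is the coefficient of epsilon_(i+1). *)
Notation weight n := 'rV[rat]_n.

Definition integral_weight n : set (weight n) :=
  [set k | forall i, k 0 i \is a Num.int].

Definition half_odd_weight n : set (weight n) :=
  [set k | forall i, k 0 i - 2^-1 \is a Num.int].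

Definition weight_lattice (G : classical_group) n : set (weight n) :=
  match G with
  | GL | Sp => @integral_weight n
  | SOodd | SOeven => @integral_weight n `|` @half_odd_weight n
  end.
Arguments weight_lattice : clear implicits.

(* In the case [SOeven] the last condition reads
   lambda_(n-1) >= |lambda_n|; it is empty when n = 1. *)
Definition dominant (G : classical_group) n (l : weight n) : Prop :=
  (forall i j : 'I_n, (i <= j)%N -> l 0 j <= l 0 i) /\
  match G with
  | GL => True
  | SOodd | Sp => forall i : 'I_n, 0 <= l 0 i
  | SOeven => forall i j : 'I_n, i.+1 = j -> j.+1 = n -> `|l 0 j| <= l 0 i
  end.

Definition dominant_weights (G : classical_group) n : set (weight n) :=
  [set l | weight_lattice G n l /\ dominant G l].
Arguments dominant_weights : clear implicits.

Definition weyl_vector (G : classical_group) n : weight n :=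
  \row_(i < n)
    match G with
    | GL | SOeven => n%:R - i.+1%:R
    | SOodd => n%:R + 2^-1 - i.+1%:R
    | Sp => n%:R + 1 - i.+1%:R
    end.

(* The pair (s, A) is the signed permutation that permutes the coordinates by
   s and then changes the sign of those with index in A. *)
Notation signed_perm n := ('S_n * {set 'I_n})%type.

Definition weyl_group (G : classical_group) n : pred (signed_perm n) :=
  fun w => match G with
  | GL => w.2 == finset.set0
  | SOodd | Sp => true
  | SOeven => ~~ odd #|w.2|
  end.

Definition weyl_mx n (w : signed_perm n) : 'M[int]_n :=
  perm_mx w.1 *m diag_mx (\row_(i < n) (-1) ^+ (i \in w.2)).

Definition weyl_act n (w : signed_perm n) (k : weight n) : weight n :=
  k *m map_mx intr (weyl_mx w).

Definition weyl_sgn n (w : signed_perm n) : int := \det (weyl_mx w).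

(* The field of rational functions in x_1^(1/2), ..., x_n^(1/2) over the
   fraction field of R: the polynomial variable 'X_i stands for the square root
   of x_(i+1), which gives a meaning to half-odd exponents. *)
Notation ratfun R n := {fraction {mpoly R[n]}}.

Definition coef (R : idomainType) n (c : R) : ratfun R n :=
  tofrac (c%:MP : {mpoly R[n]}).

(* x^k; for k in (1/2)Z^n, [numq (2 * k 0 i)] is the integer 2 k_(i+1). *)
Definition xpow (R : idomainType) n (k : weight n) : ratfun R n :=
  \prod_(i < n) (tofrac ('X_i : {mpoly R[n]})) ^ (numq (2 * k 0 i)).

Definition alternant (R : idomainType) (G : classical_group) n (k : weight n) :
    ratfun R n :=
  \sum_(w | weyl_group G w) (weyl_sgn w)%:~R * xpow R (weyl_act w k).

(* The character of the irreducible representation of highest weight l, as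
   given by Weyl's formula. *)
Definition weyl_char (R : idomainType) (G : classical_group) n (l : weight n) :
    ratfun R n :=
  alternant R G (l + weyl_vector G n) / alternant R G (weyl_vector G n).

Definition dot_act (G : classical_group) n (w : signed_perm n) (k : weight n) :
    weight n :=
  weyl_act w (k + weyl_vector G n) - weyl_vector G n.

(* Main.v *)
Require Import Defs.
From HB Require Import structures.
From mathcomp Require Import all_boot all_order all_algebra all_fingroup.
From mathcomp Require Import finmap.
From mathcomp Require Import boolp classical_sets cardinality fsbigop.
From mathcomp Require Import mpoly.
From mathcomp Require Import ring lra.

Set Implicit Arguments.
Unset Strict Implicit.
Unset Printing Implicit Defensive.

Import Order.TTheory GRing.Theory Num.Theory.

Local Open Scope ring_scope.
Local Open Scope classical_set_scope.

(** Let A(v) be the alternant of v, the sum of sgn(w) x^(w v) over the Weyl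
    group W, so that ch_l = A(l + rho) / A(rho). Multiply the invariant sum
    sum_k a(k) x^k by A(rho) and, in front of the term sgn(w) x^(w rho), use
    the invariance to replace x^k by x^(w k). Since
    x^(w k) x^(w rho) = x^(w (k + rho)), exchanging the two sums gives
    sum_k a(k) A(k + rho) (invariant_sum_alternant).

    It remains to recognise A(k + rho). The alternant is skew:
    A(v) = sgn(u) A(u v) (alternant_act). Hence, if w(k + rho) = l + rho with l
    dominant, then A(k + rho) / A(rho) = sgn(w) ch_l, whatever the choice of w
    (alternant_dot_act); such an l is unique (dot_act_unique). If no such l
    exists, then A(k + rho) = 0 (exists_dominant).

    For the last two points the four groups are treated together. The open
    chamber is the set of vectors lying strictly on the positive side of the
    hyperplane of every reflection of W. An element u v of the orbit of v that
    maximises the scalar product with rho is on the nonnegative side of all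
    these hyperplanes, since a reflection could otherwise increase the product.
    Either it is strictly inside, or it is fixed by a reflection and A(v) = 0
    (exists_chamber). Two points of the chamber in the same orbit coincide, and
    the stabiliser of such a point is trivial (chamber_free); the case of rho
    gives A(rho) <> 0 because the monomials x^(w rho) are then distinct.
    Finally the weights of the lattice that lie in the chamber after a shift by
    rho are the dominant ones (chamber_dominant, dominant_chamber). *)

(** * Signed permutations and alternants *)

(** The product in the order for which weyl_act is a right action: u acts
    first, and its signs are then carried along by the permutation of w. *)
Definition signed_mul n (u w : signed_perm n) : signed_perm n :=
  ((u.1 * w.1)%g,
   finset (fun i => ((w.1^-1)%g i \in u.2) (+) (i \in w.2))).

Lemma weyl_actE n (w : signed_perm n) (k : weight n) i :
  weyl_act w k 0 i = (-1) ^+ (i \in w.2) * k 0 ((w.1^-1)%g i).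
Proof.
rewrite mxE (bigD1 ((w.1^-1)%g i)) //= big1 ?addr0 => [|j ji].
  rewrite mxE mxE (bigD1 i) //= big1 ?addr0 => [|l li].
    by rewrite !mxE permKV !eqxx mul1r mulr1n rmorphXn rmorphN1 mulrC.
  by rewrite !mxE permKV (negPf li) eq_sym (negPf li) mul0r.
rewrite mxE mxE big1 ?rmorph0 ?mulr0 // => l _.
rewrite !mxE; have [jl|] := eqVneq; last by rewrite mul0r.
have [li|] := eqVneq; last by rewrite mulr0.
by case/eqP: ji; rewrite -li -jl permK.
Qed.

Lemma prodr_sign n (A : {set 'I_n}) :
  \prod_i (-1) ^+ (i \in A) = (-1) ^+ odd #|A| :> int.
Proof.
rewrite signr_odd -sum1_card [in RHS]big_mkcond -[RHS]prodrXr.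
by apply: eq_bigr => i _; case: (i \in A).
Qed.

Lemma weyl_sgnE n (w : signed_perm n) :
  weyl_sgn w = (-1) ^+ (odd_perm w.1 (+) odd #|w.2|).
Proof.
rewrite /weyl_sgn /weyl_mx det_mulmx det_perm det_diag signr_addb -prodr_sign.
by congr (_ * _); apply: eq_bigr => i _; rewrite mxE.
Qed.

Lemma odd_card_signed_mul n (u w : signed_perm n) :
  odd #|(signed_mul u w).2| = odd #|u.2| (+) odd #|w.2|.
Proof.
apply: (@signr_inj int); rewrite signr_addb -!prodr_sign.
rewrite [X in _ = X * _](reindex_inj (@perm_inj _ (w.1^-1)%g)) -big_split /=.
by apply: eq_bigr => i _; rewrite inE signr_addb.
Qed.

Lemma weyl_sgnM n (u w : signed_perm n) :
  weyl_sgn (signed_mul u w) = weyl_sgn u * weyl_sgn w.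
Proof.
rewrite !weyl_sgnE odd_card_signed_mul odd_permM -signr_addb.
by congr (_ ^+ nat_of_bool _); rewrite addbACA.
Qed.

Lemma weyl_actM n (u w : signed_perm n) (k : weight n) :
  weyl_act (signed_mul u w) k = weyl_act w (weyl_act u k).
Proof.
apply/rowP => i; rewrite !weyl_actE inE signr_addb invMg permM mulrA.
by rewrite [_ * (-1) ^+ _]mulrC.
Qed.

Lemma weyl_actD n (w : signed_perm n) (k l : weight n) :
  weyl_act w (k + l) = weyl_act w k + weyl_act w l.
Proof. exact: mulmxDl. Qed.

(** Closure under the product and its converse at once: what reindexing a sum
    over the group by u requires. *)
Lemma weyl_groupM G n (u w : signed_perm n) :
  weyl_group G u -> weyl_group G (signed_mul u w) = weyl_group G w.
Proof.
case: G => //= [/eqP u0|]; last first.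
  by move=> /negbTE u0; rewrite odd_card_signed_mul u0.
congr (_ == _); apply/setP => i.
by rewrite !inE u0 inE.
Qed.

Lemma signed_mulI n (u : signed_perm n) : injective (signed_mul u).
Proof.
move=> [s A] [t B] [/mulgI/= -> /setP AB]; congr (_, _).
by apply/setP => i; have := AB i; rewrite !inE => /addbI.
Qed.

Lemma weyl_group1 G n : weyl_group G ((1%g, finset.set0) : signed_perm n).
Proof. by case: G => //=; rewrite ?eqxx ?cards0. Qed.

Lemma weyl_act1 n (k : weight n) : weyl_act (1%g, finset.set0) k = k.
Proof. by apply/rowP => i; rewrite weyl_actE inE mul1r invg1 perm1. Qed.

Lemma alternant_act (R : idomainType) G n (u : signed_perm n) (k : weight n) :
  weyl_group G u ->
  alternant R G k = (weyl_sgn u)%:~R * alternant R G (weyl_act u k).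
Proof.
move=> Gu; rewrite /alternant (reindex_inj (@signed_mulI n u)) mulr_sumr.
apply: eq_big => [w|w _]; first exact: weyl_groupM.
by rewrite weyl_sgnM weyl_actM rmorphM mulrA.
Qed.

(** The terms of w and r w cancel. Skewness alone would only give A = - A,
    which says nothing in characteristic 2; hence the pairing of the elements of
    sign 1 with those of sign -1. *)
Lemma alternant_wall (R : idomainType) G n (r : signed_perm n) (k : weight n) :
  weyl_group G r -> weyl_sgn r = -1 -> weyl_act r k = k -> alternant R G k = 0.
Proof.
move=> Gr r1 rk; rewrite /alternant (bigID (fun w => weyl_sgn w == 1)) /=.
rewrite [X in _ + X](reindex_inj (@signed_mulI n r)) /=; apply/eqP.
rewrite addr_eq0 -sumrN; apply/eqP/eq_big => [w|w _].
  rewrite weyl_groupM // weyl_sgnM r1 mulN1r weyl_sgnE.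
  by case: (_ (+) _).
by rewrite weyl_actM rk weyl_sgnM r1 mulN1r rmorphN mulNr opprK.
Qed.

(** * Monomials with half-integral exponents *)

(** The exponents for which xpow is a genuine monomial: elsewhere numq (2 k_i)
    differs from 2 k_i. *)
Definition half_integral n (k : weight n) : Prop :=
  forall i, 2 * k 0 i \is a Num.int.

Lemma half_integralD n (k l : weight n) :
  half_integral k -> half_integral l -> half_integral (k + l).
Proof. by move=> hk hl i; rewrite mxE mulrDr rpredD. Qed.

Lemma half_integral_act n (w : signed_perm n) (k : weight n) :
  half_integral k -> half_integral (weyl_act w k).
Proof. by move=> hk i; rewrite weyl_actE mulrCA rpredMsign. Qed.

Lemma numq2K n (k : weight n) i :
  half_integral k -> (numq (2 * k 0 i))%:~R = 2 * k 0 i.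
Proof. by move=> hk; apply: numqK; exact: hk. Qed.

Lemma tofracX_neq0 (R : idomainType) n (i : 'I_n) :
  tofrac ('X_i : {mpoly R[n]}) != 0.
Proof.
rewrite tofrac_eq0; apply/eqP => /(congr1 (mcoeff U_(i))).
by rewrite mcoeff0 mcoeffXU eqxx => /eqP; rewrite oner_eq0.
Qed.

Lemma xpowD (R : idomainType) n (k l : weight n) :
  half_integral k -> half_integral l ->
  xpow R (k + l) = xpow R k * xpow R l.
Proof.
move=> hk hl; rewrite /xpow -big_split; apply: eq_bigr => i _ /=.
rewrite -expfzDr ?tofracX_neq0 //; congr (_ ^ _).
apply: (@intr_inj rat).
rewrite rmorphD /= !numq2K //; last exact: half_integralD.
by rewrite mxE mulrDr.
Qed.

(** Distinct monomials are linearly independent. After multiplication by a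
    large power of the product of all the variables, the exponents become
    natural numbers and the coefficients of a polynomial can be compared. *)
Lemma sum_xpow_neq0 (R : idomainType) n (I : finType) (P : pred I) (c : I -> R)
    (f : I -> weight n) (i0 : I) :
  P i0 -> c i0 != 0 -> (forall i, P i -> half_integral (f i)) ->
  (forall i, P i -> f i = f i0 -> i = i0) ->
  \sum_(i | P i) coef n (c i) * xpow R (f i) != 0.
Proof.
move=> Pi0 ci0 hf f_inj.
(* N bounds all the exponents that occur, in absolute value. *)
pose N := (\sum_i \sum_j `|numq (2 * f i 0%R j)|)%N.
pose m i : 'X_{1..n} := [multinom `|(numq (2 * f i 0%R j) + N%:Z)%R| | j < n]%N.
have mE i j : (m i j)%:Z = numq (2 * f i 0 j) + N%:Z.
  rewrite mnmE gez0_abs // addrC -[numq _]opprK subr_ge0.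
  apply: le_trans (ler_norm _) _; rewrite normrN -abszE lez_nat.
  rewrite /N (bigD1 i) //= (bigD1 j) //= -addnA; exact: leq_addr.
pose M : ratfun R n := \prod_j tofrac ('X_j : {mpoly R[n]}) ^+ N.
apply/eqP => /(congr1 (fun z => z * M)).
rewrite mul0r mulr_suml.
have E i : coef n (c i) * xpow R (f i) * M = tofrac (c i *: 'X_[m i]).
  rewrite -mul_mpolyC tofracM -mulrA; congr (_ * _).
  rewrite mpolyXE_id rmorph_prod -big_split; apply: eq_bigr => j _ /=.
  by rewrite exprnP -expfzDr ?tofracX_neq0 // -mE -exprnP tofracXn.
under eq_bigr do rewrite E.
rewrite -rmorph_sum => /eqP; rewrite tofrac_eq0.
move=> /eqP/(congr1 (mcoeff (m i0))).
rewrite raddf_sum (bigD1 i0) //= big1 ?mcoeff0 => [|i /andP[Pi ii0]].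
  by rewrite addr0 mcoeffZ mcoeffX eqxx mulr1; apply/eqP.
rewrite mcoeffZ mcoeffX; case: eqP => [mi|]; last by rewrite mulr0.
case/eqP: ii0; apply: f_inj => //; apply/rowP => j.
have := mE i j; rewrite mi mE => /addIr /(congr1 (intr : int -> rat)).
rewrite !numq2K; try exact: hf.
by move=> /mulfI ->.
Qed.

(** When the stabiliser of k is trivial, no other term can cancel x^k. *)
Lemma alternant_neq0 (R : idomainType) G n (k : weight n) :
  half_integral k ->
  (forall w, weyl_group G w -> weyl_act w k = k -> w = (1%g, finset.set0)) ->
  alternant R G k != 0.
Proof.
move=> hk k_free; rewrite /alternant.
have intE (z : int) : z%:~R = coef n (z%:~R : R).
  by rewrite /coef !rmorph_int.
under eq_bigr do rewrite intE.
apply: (@sum_xpow_neq0 _ _ _ _ _ _ (1%g, finset.set0)).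
- exact: weyl_group1.
- by rewrite weyl_sgnE odd_perm1 cards0 oner_eq0.
- by move=> w _; exact: half_integral_act.
- by move=> w Gw; rewrite weyl_act1; exact: k_free.
Qed.

(** * Reflections and the open chamber *)

(** The reflections of the hyperoctahedral group: refl_pair i j e is the one
    in the root epsilon_i - epsilon_j (e = false) or epsilon_i + epsilon_j
    (e = true), and refl_coord i is the one in epsilon_i. *)
Definition refl_pair n (i j : 'I_n) (e : bool) : signed_perm n :=
  (tperm i j, if e then finset.setU [set i]%SET [set j]%SET else finset.set0).

Definition refl_coord n (i : 'I_n) : signed_perm n := (1%g, [set i]%SET).

(** The dominant open Weyl chamber. Testing which reflections belong to the Weyl
    group makes one definition serve the four types. *)
Definition chamber G n (k : weight n) : Prop :=
  (forall (i j : 'I_n) e, (i < j)%N -> weyl_group G (refl_pair i j e) ->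
     (-1) ^+ e * k 0 j < k 0 i) /\
  (forall i : 'I_n, weyl_group G (refl_coord i) -> 0 < k 0 i).

Lemma refl_pairE n (i j : 'I_n) e (k : weight n) l : i != j ->
  weyl_act (refl_pair i j e) k 0 l =
  if l == i then (-1) ^+ e * k 0 j else
  if l == j then (-1) ^+ e * k 0 i else k 0 l.
Proof.
move=> ij; rewrite weyl_actE /= tpermV.
have [->|li] := eqVneq l i.
  by rewrite tpermL; case: e; rewrite !inE ?eqxx.
have [->|lj] := eqVneq l j.
  by rewrite tpermR; case: e; rewrite !inE ?eqxx ?orbT.
rewrite tpermD 1?eq_sym //; case: e; rewrite !inE ?(negPf li) ?(negPf lj);
  by rewrite mul1r.
Qed.

Lemma refl_coordE n (i : 'I_n) (k : weight n) l :
  weyl_act (refl_coord i) k 0 l = if l == i then - k 0 i else k 0 l.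
Proof.
rewrite weyl_actE /= invg1 perm1 inE; case: eqP => [->|_]; last exact: mul1r.
exact: mulN1r.
Qed.

Lemma sgn_refl_pair n (i j : 'I_n) e :
  i != j -> weyl_sgn (refl_pair i j e) = -1.
Proof.
move=> ij; rewrite weyl_sgnE /= odd_tperm ij.
by case: e; rewrite ?cards2 ?ij ?cards0.
Qed.

Lemma sgn_refl_coord n (i : 'I_n) : weyl_sgn (refl_coord i) = -1.
Proof. by rewrite weyl_sgnE /= odd_perm1 cards1. Qed.

Lemma chamber_weyl_vector G n : chamber G (weyl_vector G n).
Proof.
split=> [i j e ij Gr|i Gr]; rewrite !mxE.
- have := ltn_ord j; rewrite -(ler_nat rat j.+1) -[j.+1%:R]natr1.
  move: ij; rewrite -(ler_nat rat i.+1) -[i.+1%:R]natr1 => ij jn.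
  by case: G e Gr => -[] _ /=; lra.
have := ltn_ord i; rewrite -(ler_nat rat i.+1) -[i.+1%:R]natr1 => iln.
case: G Gr => /= [/eqP Gr|_|_|]; try lra.
  by have := cards1 i; rewrite Gr cards0.
by rewrite cards1.
Qed.

Definition dot n (k l : weight n) : rat := \sum_i k 0 i * l 0 i.

(** With alpha = epsilon_i -/+ epsilon_j, this is the identity
    <k - r k, l> = <k, alpha> <alpha, l>, the formula for a reflection in a root
    of square length 2. *)
Lemma dot_refl_pair n (i j : 'I_n) e (k l : weight n) : i != j ->
  dot k l - dot (weyl_act (refl_pair i j e) k) l =
  (k 0 i - (-1) ^+ e * k 0 j) * (l 0 i - (-1) ^+ e * l 0 j).
Proof.
move=> ij; rewrite /dot -sumrB (bigD1 i) //= (bigD1 j) 1?eq_sym //=.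
rewrite big1 => [|p /andP[pi pj]].
  rewrite !refl_pairE // !eqxx [j == i]eq_sym (negPf ij).
  by case: e; ring.
by rewrite refl_pairE // (negPf pi) (negPf pj) subrr.
Qed.

Lemma dot_refl_coord n (i : 'I_n) (k l : weight n) :
  dot k l - dot (weyl_act (refl_coord i) k) l = 2 * k 0 i * l 0 i.
Proof.
rewrite /dot -sumrB (bigD1 i) //= big1 => [|p pi].
  by rewrite refl_coordE eqxx; ring.
by rewrite refl_coordE (negPf pi) subrr.
Qed.

(** The element of the orbit of k that maximises the scalar product with rho
    pairs nonnegatively with every positive root; a vanishing pairing means that
    it is fixed by a reflection, which would make the alternant vanish. *)
Lemma exists_chamber (R : idomainType) G n (k : weight n) :
  alternant R G k != 0 ->
  exists2 u, weyl_group G u & chamber G (weyl_act u k).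
Proof.
move=> k_reg.
pose f u := dot (weyl_act u k) (weyl_vector G n).
case: (@arg_maxP _ _ _ (1%g, finset.set0) _ f (weyl_group1 G n)) => u Gu u_max.
exists u => //; set m := weyl_act u k.
have r_move r : weyl_group G r -> weyl_sgn r = -1 -> weyl_act r m != m.
  move=> Gr r1; apply: contraNneq k_reg => rm.
  by rewrite (alternant_act R _ Gu) (alternant_wall R Gr r1 rm) mulr0.
have r_le r : weyl_group G r ->
    0 <= dot m (weyl_vector G n) - dot (weyl_act r m) (weyl_vector G n).
  move=> Gr; rewrite subr_ge0 -weyl_actM; apply: u_max.
  by rewrite /= weyl_groupM.
have [rho_pair rho_coord] := chamber_weyl_vector G n.
split=> [i j e ij Gr|i Gr].
- have nij : i != j by rewrite neq_ltn ij.
  have := r_le _ Gr; rewrite dot_refl_pair // pmulr_lge0 ?subr_gt0;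
    last exact: rho_pair.
  rewrite subr_ge0 le_eqVlt => /predU1P[mij|//].
  have /eqP[] := r_move _ Gr (sgn_refl_pair e nij).
  apply/rowP => l; rewrite refl_pairE //.
  case: eqP => [->//|_]; case: eqP => [->|//].
  by rewrite -mij mulrA -signr_addb addbb mul1r.
- have := r_le _ Gr; rewrite dot_refl_coord pmulr_lge0; last exact: rho_coord.
  rewrite pmulr_rge0 // le_eqVlt => /predU1P[mi|//].
  have /eqP[] := r_move _ Gr (sgn_refl_coord i).
  apply/rowP => l; rewrite refl_coordE.
  by case: eqP => [->|//]; rewrite -mi oppr0.
Qed.

(** An increasing permutation moves no index down, and neither does its
    inverse, which is increasing as well. *)
Lemma perm_incr_id n (s : 'S_n) :
  (forall i j : 'I_n, (i < j)%N -> (s i < s j)%N) -> s = 1%g.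
Proof.
move=> s_incr.
have le_incr (t : 'S_n) : (forall i j : 'I_n, (i < j)%N -> (t i < t j)%N) ->
    forall i : 'I_n, (i <= t i)%N.
  move=> t_incr [m]; elim: m => //= m IH mn.
  apply: leq_ltn_trans (IH (ltnW mn)) _; exact: t_incr.
have sV_incr (i j : 'I_n) : (i < j)%N -> ((s^-1)%g i < (s^-1)%g j)%N.
  move=> ij; case: ltngtP => // [/s_incr|/val_inj/perm_inj ji].
    by rewrite !permKV ltnNge (ltnW ij).
  by rewrite ji ltnn in ij.
apply/permP => i; rewrite perm1; apply/val_inj/eqP; rewrite eqn_leq.
by rewrite (le_incr s) // andbT -{2}[i](permK s) (le_incr (s^-1)%g).
Qed.

(** Outside GL(n) both sign choices give reflections of the group, so only the
    last coordinate of a vector of the chamber may fail to be positive. *)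
Lemma chamber_abs G n (k : weight n) (i j : 'I_n) :
  G <> GL -> chamber G k -> (i < j)%N -> `|k 0 j| < k 0 i.
Proof.
move=> nGL [k_pair _] ij; have nij : i != j by rewrite neq_ltn ij.
have Gr e : weyl_group G (refl_pair i j e).
  by case: G nGL {k_pair} => //=; case: e; rewrite ?cards2 ?nij ?cards0.
have := k_pair _ _ true ij (Gr _); have := k_pair _ _ false ij (Gr _).
by rewrite mul1r mulN1r => k1 k2; rewrite ltr_norml k1 andbT ltrNl.
Qed.

(** The coordinates (for GL(n)) or their absolute values (otherwise) decrease
    strictly along a vector of the chamber, so w permutes them in increasing
    order: its permutation is trivial. Its sign changes can only concern
    coordinates that are not positive, that is none, or the last one for
    SO(2n); a single sign change is excluded there by parity. *)
Lemma chamber_free G n (w : signed_perm n) (k : weight n) :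
  weyl_group G w -> chamber G k -> chamber G (weyl_act w k) ->
  w = (1%g, finset.set0).
Proof.
move=> Gw ck cwk.
(* h stands for the coordinates or for their absolute values. *)
have decr_id (h : weight n -> 'I_n -> rat) :
    (forall l, chamber G l -> forall i j : 'I_n, (i < j)%N -> h l j < h l i) ->
    (forall i, h (weyl_act w k) i = h k ((w.1^-1)%g i)) -> w.1 = 1%g.
  move=> h_decr hw; apply: invg_inj; rewrite invg1.
  apply: perm_incr_id => i j ij.
  have := h_decr _ cwk _ _ ij; rewrite !hw.
  case: ltngtP => // [/(h_decr _ ck)/lt_gtF->//|/val_inj ->].
  by rewrite ltxx.
have w1 : w.1 = 1%g.
  have [EG|nGL] := pselect (G = GL).
    apply: (decr_id (fun l i => l 0 i)) => [l [l_pair _] i j ij|i].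
      by have := l_pair _ _ false ij; rewrite EG mul1r /= eqxx; apply.
    by rewrite weyl_actE; move: Gw; rewrite EG => /eqP ->; rewrite inE mul1r.
  apply: (decr_id (fun l i => `|l 0 i|)) => [l cl i j ij|i].
    by apply: lt_le_trans (chamber_abs nGL cl ij) (ler_norm _).
  by rewrite weyl_actE normrMsign.
suff w2 : w.2 = finset.set0 by rewrite [w]surjective_pairing w1 w2.
have wk i : weyl_act w k 0 i = (-1) ^+ (i \in w.2) * k 0 i.
  by rewrite weyl_actE w1 invg1 perm1.
have pos_notin i : 0 < k 0 i -> 0 < weyl_act w k 0 i -> i \notin w.2.
  move=> ki; rewrite wk; case: (i \in w.2) => //.
  by rewrite mulN1r oppr_gt0 ltNge (ltW ki).
case: (set_0Vmem w.2) => // -[i iw].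
have [EG|nGL] := pselect (G = GL).
  by move: Gw; rewrite EG => /eqP.
have no_gt (a b : 'I_n) : a \in w.2 -> ~ (a < b)%N.
  move=> aw ab; suff: a \notin w.2 by rewrite aw.
  apply: pos_notin; apply: le_lt_trans (normr_ge0 _) _.
    exact: chamber_abs nGL ck ab.
  exact: chamber_abs nGL cwk ab.
have w2i : w.2 = [set i]%SET.
  apply/setP => j; rewrite inE; apply/idP/eqP => [jw|-> //].
  by apply/val_inj/eqP; case: ltngtP => // [/(no_gt _ _ jw)|/(no_gt _ _ iw)].
have Gr : weyl_group G (refl_coord i).
  by case: G nGL Gw {ck cwk decr_id no_gt} => //=; rewrite w2i.
by have := pos_notin i (ck.2 _ Gr) (cwk.2 _ Gr); rewrite iw.
Qed.

(** * Dominant weights and the shifted chamber *)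

Lemma int_gtN1 (x : rat) : x \is a Num.int -> -1 < x -> 0 <= x.
Proof.
move=> /intrP[z ->].
by rewrite -[-1]/((-1)%:~R) ltr_int ler0z -ltzD1 -ltrBlDr.
Qed.

Lemma lattice_half_integral G n (k : weight n) :
  weight_lattice G n k -> half_integral k.
Proof.
have int_half : integral_weight k -> half_integral k.
  by move=> ik i; rewrite rpredM ?ik.
have odd_half : half_odd_weight k -> half_integral k.
  move=> ok i; have -> : 2 * k 0 i = 2 * (k 0 i - 2^-1) + 1 by field.
  by rewrite rpredD ?rpredM ?ok.
by case: G => //= -[].
Qed.

Lemma lattice_sub G n (k : weight n) i j :
  weight_lattice G n k -> k 0 i - k 0 j \is a Num.int.
Proof.
have int_sub : integral_weight k -> k 0 i - k 0 j \is a Num.int.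
  by move=> ik; rewrite rpredB ?ik.
have odd_sub : half_odd_weight k -> k 0 i - k 0 j \is a Num.int.
  move=> ok; have -> : k 0 i - k 0 j = (k 0 i - 2^-1) - (k 0 j - 2^-1) by ring.
  by rewrite rpredB ?ok.
by case: G => //= -[].
Qed.

Lemma lattice_congr G n (k l : weight n) :
  weight_lattice G n k -> (forall i, l 0 i - k 0 i \is a Num.int) ->
  weight_lattice G n l.
Proof.
move=> + lk.
have int_congr : integral_weight k -> integral_weight l.
  by move=> ik i; rewrite -(subrK (k 0 i) (l 0 i)) rpredD ?ik.
have odd_congr : half_odd_weight k -> half_odd_weight l.
  by move=> ok i; rewrite -(subrK (k 0 i) (l 0 i)) -addrA rpredD ?ok ?lk.
by case: G => //= -[/int_congr|/odd_congr] ?; [left|right|left|right].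
Qed.

Lemma weyl_vector_sub G n (i j : 'I_n) :
  weyl_vector G n 0 i - weyl_vector G n 0 j = j%:R - i%:R.
Proof. by rewrite !mxE -[i.+1%:R]natr1 -[j.+1%:R]natr1; case: G; ring. Qed.

Lemma half_integral_weyl_vector G n : half_integral (weyl_vector G n).
Proof.
move=> i; rewrite mxE; case: G;
  try by rewrite rpredM ?rpredB ?rpredD ?rpred_nat.
have -> : 2 * (n%:R + 2^-1 - i.+1%:R) = 2 * (n%:R - i.+1%:R) + 1 :> rat.
  by field.
by rewrite rpredD ?rpredM ?rpredB ?rpred_nat.
Qed.

Lemma lattice_dot_act G n (w : signed_perm n) (k : weight n) :
  weight_lattice G n k -> weight_lattice G n (dot_act G w k).
Proof.
move=> Lk; apply: (lattice_congr Lk) => i; rewrite /dot_act.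
set rho := weyl_vector G n; set j := (w.1^-1)%g i.
rewrite [(_ - rho) 0 i]mxE [(- rho) 0 i]mxE weyl_actE [(k + rho) 0 _]mxE -/j.
have kji := lattice_sub j i Lk.
have rji : rho 0 j - rho 0 i \is a Num.int.
  by rewrite weyl_vector_sub rpredB ?rpred_nat.
case: (i \in w.2); last first.
  have -> : (-1) ^+ false * (k 0 j + rho 0 j) - rho 0 i - k 0 i =
            (k 0 j - k 0 i) + (rho 0 j - rho 0 i) by ring.
  by rewrite rpredD.
have -> : (-1) ^+ true * (k 0 j + rho 0 j) - rho 0 i - k 0 i =
  - ((k 0 j - k 0 i) + (rho 0 j - rho 0 i) + 2 * k 0 i + 2 * rho 0 i) by ring.
rewrite rpredN rpredD ?(half_integral_weyl_vector G) // rpredD //.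
  by rewrite rpredD.
exact: (lattice_half_integral Lk).
Qed.

Lemma ord_chain n (f : 'I_n -> rat) :
  (forall i j : 'I_n, i.+1 = j -> f j <= f i) ->
  forall i j : 'I_n, (i <= j)%N -> f j <= f i.
Proof.
move=> f_step i [m]; elim: m => [|m IH] mn /=.
  by rewrite leqn0 => /eqP i0; have -> // : Ordinal mn = i; apply/val_inj.
rewrite leq_eqVlt => /predU1P[im|im].
  by have -> // : Ordinal mn = i; apply/val_inj.
by apply: le_trans (IH (ltnW mn) im); apply: f_step.
Qed.

(** For a simple root alpha, <rho, alpha> is the smallest step that the
    values <k, alpha> on the lattice can take, so that
    <k + rho, alpha> > 0 forces <k, alpha> >= 0. *)
Lemma chamber_dominant G n (k : weight n) :
  weight_lattice G n k -> chamber G (k + weyl_vector G n) -> dominant G k.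
Proof.
move=> Lk ck.
have gt_pair (i j : 'I_n) e : i.+1 = j ->
    weyl_group G (refl_pair i j e) ->
    (-1) ^+ e * (k 0 j + weyl_vector G n 0 j) < k 0 i + weyl_vector G n 0 i.
  by move=> ij Gr; have := ck.1 i j e; rewrite !mxE; apply; rewrite -?ij.
have k_anti : forall i j : 'I_n, (i <= j)%N -> k 0 j <= k 0 i.
  apply: ord_chain => i j ij; rewrite -subr_ge0; apply: int_gtN1.
    exact: lattice_sub Lk.
  have := gt_pair i j false ij.
  have := weyl_vector_sub G i j; rewrite -ij -[i.+1%:R]natr1 mul1r => rho gt.
  suff /gt : weyl_group G (refl_pair i j false) by lra.
  by case: G {Lk ck gt_pair rho gt} => //=; rewrite ?eqxx ?cards0.
split=> //; have ck2 := ck.2.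
have coord_ge0 : (forall i : 'I_n, i.+1 = n -> 0 <= k 0 i) ->
  forall i : 'I_n, 0 <= k 0 i.
  move=> k_last i; have n0 := leq_ltn_trans (leq0n i) (ltn_ord i).
  have lt_last : (n.-1 < n)%N by rewrite prednK.
  apply: le_trans (k_last (Ordinal lt_last) _) (k_anti _ _ _) => /=.
    exact: prednK.
  by rewrite -ltnS prednK.
case: G Lk {ck k_anti} gt_pair ck2 coord_ge0 => //= Lk gt_pair ck2 coord_ge0.
- apply: coord_ge0 => i i_last; have := ck2 i isT.
  have := lattice_half_integral (G := SOodd) Lk i.
  rewrite !mxE i_last => k2 gt.
  (* Here rho_n = 1/2, and it is 2 k_n that is an integer. *)
  rewrite -(pmulr_rge0 _ (ltr0Sn _ 1)); apply: int_gtN1 => //; lra.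
- apply: coord_ge0 => i i_last; have := ck2 i isT.
  rewrite !mxE i_last => gt; apply: int_gtN1 (Lk i) _; lra.
- move=> i j ij jn; have ltij : (i < j)%N by rewrite -ij.
  have nij : i != j by rewrite neq_ltn ltij.
  have := gt_pair i j false ij; have := gt_pair i j true ij.
  rewrite /= cards2 nij cards0 => /(_ isT) gt1 /(_ isT) gt2.
  have nE : n%:R = j%:R + 1 :> rat by rewrite natr1 jn.
  have jE : j%:R = i%:R + 1 :> rat by rewrite natr1 ij.
  move: gt1 gt2; rewrite !mxE -[i.+1%:R]natr1 -[j.+1%:R]natr1 => gt1 gt2.
  have kij := lattice_sub (G := SOeven) i j Lk.
  have kij' : k 0 i + k 0 j \is a Num.int.
    have -> : k 0 i + k 0 j = (k 0 i - k 0 j) + 2 * k 0 j by ring.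
    by rewrite rpredD ?(lattice_half_integral (G := SOeven) Lk).
  have le1 : 0 <= k 0 i - k 0 j by apply: int_gtN1 kij _; lra.
  have le2 : 0 <= k 0 i + k 0 j by apply: int_gtN1 kij' _; lra.
  by rewrite ler_norml; apply/andP; split; lra.
Qed.

(** A dominant weight is weakly on the positive side of every reflecting
    hyperplane, and rho is strictly so. *)
Lemma dominant_chamber G n (k : weight n) :
  dominant G k -> chamber G (k + weyl_vector G n).
Proof.
move=> [k_anti k_last].
have [rho_pair rho_coord] := chamber_weyl_vector G n.
suff [k_pair k_coord] : (forall (i j : 'I_n) e, (i < j)%N ->
    weyl_group G (refl_pair i j e) -> (-1) ^+ e * k 0 j <= k 0 i) /\
  (forall i : 'I_n, weyl_group G (refl_coord i) -> 0 <= k 0 i).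
  split=> [i j e ij Gr|i Gr]; rewrite [X in _ < X]mxE.
    by rewrite [X in _ * X]mxE mulrDr;
      apply: ler_ltD; [apply: k_pair|apply: rho_pair].
  by apply: ltr_wpDl; [apply: k_coord|apply: rho_coord].
split=> [i j [] ij Gr|i Gr].
- rewrite mulN1r.
  case: G k_last Gr {rho_pair rho_coord} => /= [_|k0 _|k0 _|k_last _].
  + by move=> /eqP ij0; have := cards2 i j; rewrite ij0 cards0.
  + by apply: le_trans (k0 i); rewrite oppr_le0.
  + by apply: le_trans (k0 i); rewrite oppr_le0.
  (* With p and q the last two indices, k_i >= k_p >= |k_q| >= - k_j. *)
  have n0 := leq_ltn_trans (leq0n i) (ltn_ord i).
  have lt_q : (n.-1 < n)%N by rewrite prednK.
  have jq : (j <= n.-1)%N by rewrite -ltnS prednK.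
  have q0 := leq_ltn_trans (leq0n i) (leq_trans ij jq).
  have lt_p : (n.-2 < n)%N by apply: leq_ltn_trans lt_q; exact: leq_pred.
  have ip : (i <= n.-2)%N by rewrite -ltnS prednK // (leq_trans ij).
  apply: le_trans (k_anti i (Ordinal lt_p) ip).
  apply: le_trans (k_last _ (Ordinal lt_q) _ _); rewrite /= ?prednK //.
  apply: le_trans (_ : - k 0 (Ordinal lt_q) <= _).
    by rewrite lerN2; apply: k_anti.
  by rewrite -normrN ler_norm.
- by rewrite mul1r; apply: k_anti; exact: ltnW.
- case: G k_last Gr {rho_pair rho_coord} => //= [_ /eqP i0|_].
    by have := cards1 i; rewrite i0 cards0.
  by rewrite cards1.
Qed.

(** * Expansion in characters *)

Lemma dot_act_unique G n (u w : signed_perm n) (k : weight n) :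
  weyl_group G u -> weyl_group G w ->
  dominant G (dot_act G u k) -> dominant G (dot_act G w k) ->
  dot_act G w k = dot_act G u k.
Proof.
move=> Gu Gw /dominant_chamber cu /dominant_chamber cw.
have [v wE] : exists v, w = signed_mul u v.
  by have [g _ gK] := injF_bij (@signed_mulI n u); exists (g w); rewrite gK.
move: Gw cw; rewrite /dot_act in cu *; rewrite !subrK in cu *.
rewrite wE weyl_groupM // weyl_actM => Gv cw.
by rewrite (chamber_free Gv cu cw) weyl_act1.
Qed.

Lemma exists_dominant (R : idomainType) G n (k : weight n) :
  weight_lattice G n k -> alternant R G (k + weyl_vector G n) != 0 ->
  exists2 w, weyl_group G w & dominant_weights G n (dot_act G w k).
Proof.
move=> Lk /exists_chamber[w Gw cw]; exists w => //.
have Ll := lattice_dot_act w Lk; split=> //.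
by apply: chamber_dominant => //; rewrite /dot_act subrK.
Qed.

(** The right-hand side depends on k alone, so the signed character attached
    to k does not depend on the chosen element of the group. *)
Lemma alternant_dot_act (R : idomainType) G n (w : signed_perm n)
    (k : weight n) :
  weyl_group G w ->
  (weyl_sgn w)%:~R * weyl_char R G (dot_act G w k) =
  alternant R G (k + weyl_vector G n) / alternant R G (weyl_vector G n).
Proof.
by move=> Gw; rewrite /weyl_char /dot_act subrK mulrA -alternant_act.
Qed.

Lemma alternant_weyl_vector_neq0 (R : idomainType) G n :
  alternant R G (weyl_vector G n) != 0.
Proof.
apply: alternant_neq0; first exact: half_integral_weyl_vector.
move=> w Gw w_rho; have c_rho := chamber_weyl_vector G n.
by apply: (chamber_free Gw c_rho); rewrite w_rho.
Qed.

Lemma fsum_finite_support (V : nmodType) (T : choiceType) (S A : set T)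
    (F : T -> V) :
  finite_set S -> (forall k, A k -> ~ S k -> F k = 0) ->
  \sum_(k \in A) F k = \sum_(k <- fset_set S) if k \in A then F k else 0.
Proof.
move=> finS F0; rewrite -[in LHS](setIT A) fsbig_mkcondl.
rewrite (fsbigTE (fset_set S)) // => k; rewrite in_fset_set // => kS.
case: ifPn => //; rewrite inE => Ak; apply: F0 => // Sk.
by move: kS; rewrite mem_set.
Qed.

(** Multiplied by A(rho), the left-hand side becomes the sum over w and k of
    a(k) sgn(w) x^(w k) x^(w rho), the invariance being applied with a
    different w in front of each term of A(rho). *)
Lemma invariant_sum_alternant (R : idomainType) G n (a : weight n -> R)
    (s : seq (weight n)) :
  (forall k, k \in s -> half_integral k) ->
  (forall w, weyl_group G w ->
     \sum_(k <- s) coef n (a k) * xpow R k =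
     \sum_(k <- s) coef n (a k) * xpow R (weyl_act w k)) ->
  \sum_(k <- s) coef n (a k) * xpow R k =
  \sum_(k <- s) coef n (a k) *
    (alternant R G (k + weyl_vector G n) / alternant R G (weyl_vector G n)).
Proof.
move=> s_half a_inv; have D0 := alternant_weyl_vector_neq0 R G n.
apply: (mulIf D0); rewrite [RHS]mulr_suml {1}/alternant mulr_sumr.
rewrite (eq_bigr (fun w =>
  \sum_(k <- s) coef n (a k) * xpow R (weyl_act w k) *
    ((weyl_sgn w)%:~R * xpow R (weyl_act w (weyl_vector G n)))))
  => [|w Gw]; last first.
  by rewrite (a_inv w Gw) mulr_suml.
rewrite exchange_big /= big_seq_cond [RHS]big_seq_cond.
apply: eq_bigr => k /andP[/s_half hk _].
rewrite -mulrA divfK // /alternant mulr_sumr; apply: eq_bigr => w _.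
rewrite weyl_actD xpowD; first by ring.
  exact: half_integral_act.
by apply: half_integral_act; exact: half_integral_weyl_vector.
Qed.

Theorem proposition2p1 (R : idomainType) (n : nat) (hn : (1 <= n)%N)
    (G : classical_group) (a : weight n -> R)
    (* the formal sum of the a(k) x^k is a finite one *)
    (a_fin : finite_set [set k : weight n | weight_lattice G n k /\ a k <> 0])
    (a_inv : forall w : signed_perm n, weyl_group G w ->
       \sum_(k \in weight_lattice G n) coef n (a k) * xpow R k =
       \sum_(k \in weight_lattice G n) coef n (a k) * xpow R (weyl_act w k))
    (* any choice of the elements w_(k,l), where they exist *)
    (wkl : weight n -> weight n -> signed_perm n)
    (wkl_spec : forall k l : weight n,
       weight_lattice G n k -> dominant_weights G n l ->
       (exists w : signed_perm n, weyl_group G w /\ dot_act G w k = l) ->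
       weyl_group G (wkl k l) /\ dot_act G (wkl k l) k = l) :
  \sum_(k \in weight_lattice G n) coef n (a k) * xpow R k =
  \sum_(l \in dominant_weights G n)
    \sum_(k \in [set k : weight n | weight_lattice G n k /\
                   exists w : signed_perm n,
                     weyl_group G w /\ dot_act G w k = l])
      (weyl_sgn (wkl k l))%:~R * coef n (a k) * weyl_char R G l.
Proof.
pose S := [set k : weight n | weight_lattice G n k /\ a k <> 0].
have coef0 k : weight_lattice G n k -> ~ S k -> coef n (a k) = 0.
  move=> Lk nSk; have -> : a k = 0 by apply: contrapT => ak; apply: nSk.
  by rewrite /coef mpolyC0 tofrac0.
have sum_L (F : weight n -> ratfun R n) :
    \sum_(k \in weight_lattice G n) coef n (a k) * F k =
    \sum_(k <- fset_set S) coef n (a k) * F k.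
  rewrite (@fsum_finite_support _ _ S) //
    => [|k Lk /coef0 ->//]; last exact: mul0r.
  rewrite big_seq [RHS]big_seq; apply: eq_bigr => k.
  by rewrite in_fset_set // inE => -[Lk _]; rewrite mem_set.
rewrite sum_L (@invariant_sum_alternant R G n); first last.
- by move=> w Gw; rewrite -!sum_L; exact: a_inv.
- move=> k; rewrite in_fset_set // inE => -[Lk _].
  exact: lattice_half_integral Lk.
pose K l := [set k : weight n | weight_lattice G n k /\
               exists w : signed_perm n, weyl_group G w /\ dot_act G w k = l].
pose T := [set dot_act G p.2 p.1 | p in S `*` [set: signed_perm n]].
have finT : finite_set T.
  by apply: finite_image; apply: finite_setX => //; exact: finite_finset.
have KT k l : S k -> K l k -> T l.
  by move=> Sk [_ [w [_ <-]]]; exists (k, w).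
have sum_K l : \sum_(k \in K l)
      (weyl_sgn (wkl k l))%:~R * coef n (a k) * weyl_char R G l =
    \sum_(k <- fset_set S) if k \in K l
      then (weyl_sgn (wkl k l))%:~R * coef n (a k) * weyl_char R G l else 0.
  apply: fsum_finite_support => // k [Lk _] /coef0 -> //.
  by rewrite mulr0 mul0r.
rewrite (@fsum_finite_support _ _ T) // => [|l _ nTl]; last first.
  rewrite sum_K big_seq big1 // => k; rewrite in_fset_set // inE => Sk.
  by case: ifPn => //; rewrite inE => /(KT _ _ Sk).
pose ch k :=
  alternant R G (k + weyl_vector G n) / alternant R G (weyl_vector G n).
transitivity (\sum_(l <- fset_set T) \sum_(k <- fset_set S)
    if (l \in dominant_weights G n) && (k \in K l)
    then coef n (a k) * ch k else 0); last first.
  apply: eq_bigr => l _; case: ifPn => [|_]; last by rewrite big1.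
  rewrite inE => Dl; rewrite sum_K; apply: eq_bigr => k _ /=.
  case: ifPn => //; rewrite inE => -[Lk /(wkl_spec _ _ Lk Dl)[Gw wk]].
  have := alternant_dot_act R k Gw; rewrite wk => chE.
  by rewrite mulrAC chE mulrC.
(* For fixed k, at most one dominant l is reached, and exactly one when the
   alternant of k + rho does not vanish. *)
rewrite exchange_big big_seq [RHS]big_seq; apply: eq_bigr => k.
rewrite in_fset_set // inE => Sk; have Lk := Sk.1.
have [alt0|alt0] := eqVneq (alternant R G (k + weyl_vector G n)) 0.
  by rewrite /ch alt0 mul0r mulr0 big1 // => l _; rewrite if_same.
have [u Gu Du] := exists_dominant Lk alt0.
have Kk : K (dot_act G u k) k by split=> //; exists u.
rewrite (bigD1_seq (dot_act G u k)) ?fset_uniq //=; last first.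
  by rewrite in_fset_set // mem_set //; exact: KT Kk.
rewrite !mem_set //= big1 ?addr0 // => l lu.
case: ifPn => // /andP[]; rewrite !inE => -[_ Dl] [_ [w [Gw wk]]].
case/eqP: lu; rewrite -wk in Dl *; exact: dot_act_unique Gu Gw Du.2 Dl.
Qed.
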